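(* Let $f,g,h$ be polynomials with $f=gh$, $f(0)\ne0$, $g$ non-constant, and suppose that either (i) $f,g,h\in\mathbb{Z}[x]$, or (ii) $f,g,h\in\mathbb{C}[x]$ and $|\mathrm{LC}(g)|\ge1$, $|\mathrm{TC}(g)|\ge 1$. Then $$\|h\|_2\le\sqrt{\frac{\|g\|_0}{\deg g}}\cdot\|f\|_1\cdot\left(\widetilde O\left(\frac{\|g\|_0^{2.5}\,(\deg g)^2+\sqrt{\|g\|_0}\,(\deg f)^2}{\sqrt{\deg g}}\right)\right)^{\|g\|_0-1}.$$ Moreover, $$\log_2\|h\|_\infty\le\log_2\|h\|_2\le\log_2\|f\|_\infty+O\big(\|g\|_0\cdot\log_2\deg f\big).$$ All constants implicit in $\widetilde O$ and $O$ are absolute.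
   Context: For a polynomial $f=\sum_i f_ix^i\in\mathbb{C}[x]$: $\|f\|_0$ is the number of nonzero coefficients, $\|f\|_1=\sum_i|f_i|$, $\|f\|_2=(\sum_i|f_i|^2)^{1/2}$, $\|f\|_\infty=\max_i|f_i|$. $\mathrm{LC}(g)$ is the leading coefficient of $g$ (coefficient of its highest-degree nonzero term) and $\mathrm{TC}(g)$ is the trailing coefficient (coefficient of its lowest-degree nonzero term). Convention: $\widetilde O(t)=O\big(t\cdot\log^{O(1)}t\big)$. *)

(* Defs.v *)
(* The complex numbers are [R[i]] for [R : realType]. *)
From mathcomp Require Import all_boot all_order all_algebra.
From mathcomp Require Import all_classical all_reals all_analysis.
From mathcomp Require Export complex.

Set Implicit Arguments.
Unset Strict Implicit.
Unset Printing Implicit Defensive.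

Import Order.TTheory GRing.Theory Num.Theory.
Local Open Scope ring_scope.
Local Open Scope complex_scope.

(* The MathComp norm [`|z|] of [z : R[i]] lives in [R[i]]; [Normc.normc z] is
   the same modulus, with values in [R]. *)
Notation cabs := ComplexField.Normc.normc.

Definition norm0 (R : realType) (p : {poly R[i]}) : nat :=
  count (fun c => c != 0) p.

Definition norm1 (R : realType) (p : {poly R[i]}) : R :=
  \sum_(i < size p) cabs p`_i.

Definition norm2 (R : realType) (p : {poly R[i]}) : R :=
  Num.sqrt (\sum_(i < size p) cabs p`_i ^+ 2).

Definition norm_inf (R : realType) (p : {poly R[i]}) : R :=
  \big[Num.max/0]_(i < size p) cabs p`_i.

(* Equal to 0 for both constant polynomials and the zero polynomial. *)
Definition deg (R : realType) (p : {poly R[i]}) : nat := (size p).-1.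

Definition trail_coef (R : realType) (p : {poly R[i]}) : R[i] :=
  p`_(find (fun c => c != 0) p).

Definition int_poly (R : realType) (p : {poly R[i]}) : Prop :=
  exists q : {poly int}, p = map_poly intr q.

Definition log2 (R : realType) (x : R) : R := ln x / ln 2.

(* The functions of class O(t * log^O(1) t), with the two implicit constants
   made explicit: C is the multiplicative constant, k bounds the exponent of
   the logarithm.  This is only meaningful for t bounded away from 1. *)
Definition soft_O (R : realType) (C : R) (k : nat) (t : R) : R :=
  C * (t * log2 t ^+ k).

(* When f = g * h, f(0) != 0 and deg g >= 1 one has norm0 g >= 2 and
   deg f >= deg g >= 1, so the value below is larger than 7, and its
   base-2 logarithm is larger than 1. *)
Definition base_arg (R : realType) (s dg df : nat) : R :=
  (s%:R `^ (5 / 2) * dg%:R ^+ 2 + Num.sqrt s%:R * df%:R ^+ 2)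
    / Num.sqrt dg%:R.

(* Main.v *)
(* Parseval on the M-th roots of unity, M = 2^r >= 4 ||g||_0 deg g deg f, gives
   M ||h||_2^2 = \sum |h(z)|^2, and h = f / g, so it suffices that g is small at
   few of them.  For q of degree d with zeros z_k, q'/q = \sum 1 / (x - z_k);
   discarding for each z_k the nearest root of unity, the others contribute to
   \sum_x 1 / |x - z_k| at most a harmonic sum of size O(M r), so by Markov's
   inequality |q'| > y d |q| holds at no more than d + O(M r / y) points.
   Differentiating away the terms of g one at a time, from the lowest, multiplies
   the leading coefficient by exactly the degree d, so |g| < y^(1 - ||g||_0)
   holds at no more than (||g||_0 - 1)(deg g + O(M r / y)) points.  Taking y of
   order ||g||_0 (deg f) r leaves them less than half of the L2 mass of h. *)
Require Import Defs.
From mathcomp Require Import all_boot all_order all_algebra.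
From mathcomp Require Import all_classical all_reals all_analysis.
From mathcomp Require Import complex.
From mathcomp Require Import ring lra zify.
Import Order.TTheory GRing.Theory Num.Theory.
Local Open Scope ring_scope.
Local Open Scope complex_scope.

(** * The real-valued modulus on [R[i]] *)

Section Modulus.
Context {R : realType}.
Implicit Types z w : R[i].

Lemma cabs_ge0 z : 0 <= cabs z.
Proof. by case: z => a b; exact: sqrtr_ge0. Qed.

Lemma cabsM z w : cabs (z * w) = cabs z * cabs w.
Proof. exact: Normc.normcM. Qed.

Lemma cabsD z w : cabs (z + w) <= cabs z + cabs w.
Proof. exact: le_normcD. Qed.

Lemma cabsN z : cabs (- z) = cabs z.
Proof. exact: normcN. Qed.

Lemma cabs0 : cabs (0 : R[i]) = 0.
Proof. exact: Normc.normc0. Qed.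

Lemma cabs1 : cabs (1 : R[i]) = 1.
Proof. exact: Normc.normc1. Qed.

Lemma cabs_eq0 z : (cabs z == 0) = (z == 0).
Proof. by apply/eqP/eqP => [/Normc.eq0_normc //|->]; exact: cabs0. Qed.

Lemma cabs_gt0 z : (0 < cabs z) = (z != 0).
Proof. by rewrite lt0r cabs_ge0 cabs_eq0 andbT. Qed.

Lemma cabsX z n : cabs (z ^+ n) = cabs z ^+ n.
Proof. by elim: n => [|n IH]; rewrite ?expr0 ?cabs1 // !exprS cabsM IH. Qed.

Lemma cabsMn z n : cabs (z *+ n) = cabs z *+ n.
Proof. exact: normcMn. Qed.

Lemma cabs_distC z w : cabs (z - w) = cabs (w - z).
Proof. by rewrite -cabsN opprB. Qed.

Lemma cabs_sum (I : Type) (r : seq I) (P : pred I) (F : I -> R[i]) :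
  cabs (\sum_(i <- r | P i) F i) <= \sum_(i <- r | P i) cabs (F i).
Proof.
elim/big_rec2: _ => [|i x y _ le_xy]; first by rewrite cabs0.
by rewrite (le_trans (cabsD _ _)) // lerD2l.
Qed.

Lemma sqr_cabs z : (cabs z ^+ 2)%:C = z * z^*.
Proof.
case: z => a b; rewrite /Normc.normc sqr_sqrtr ?addr_ge0 ?sqr_ge0 //.
by apply/eqP; rewrite eq_complex /=; apply/andP; split; apply/eqP; ring.
Qed.

Lemma cabs_horner_le (p : {poly R[i]}) z :
  cabs z = 1 -> cabs p.[z] <= norm1 p.
Proof.
move=> z1; rewrite horner_coef (le_trans (cabs_sum _ _ _ _)) //.
by apply: ler_sum => i _; rewrite cabsM cabsX z1 expr1n mulr1.
Qed.

(** Triangle inequality along the chain of powers of [z]. It turns a lower bound for the chord at a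
    multiple of an angle into one for the chord at the angle itself. *)
Lemma cabs_1BX_le z k : cabs z = 1 -> cabs (1 - z ^+ k) <= cabs (1 - z) *+ k.
Proof.
move=> z1; elim: k => [|k IH]; first by rewrite expr0 subrr cabs0.
have -> : 1 - z ^+ k.+1 = (1 - z) + z * (1 - z ^+ k).
  by rewrite exprS mulrBr mulr1 addrA subrK.
by rewrite (le_trans (cabsD _ _)) // cabsM z1 mul1r mulrS lerD2l.
Qed.

Lemma cabs_1B_ge1 z : complex.Re z <= 0 -> 1 <= cabs (1 - z).
Proof.
case: z => a b /= a0; rewrite -[leLHS]sqrtr1 ler_wsqrtr // sub0r sqrrN.
have a1 : 1 <= 1 - a by rewrite lerDl oppr_ge0.
rewrite ler_wpDr ?sqr_ge0 //.
by rewrite expr_ge1 // (le_trans ler01 a1).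
Qed.

End Modulus.

(** * Roots of unity, chord lengths and harmonic sums *)

Section RootsOfUnity.
Context {R : realType}.

Definition cis (x : R) : R[i] := cos x +i* sin x.

Lemma cisD x y : cis (x + y) = cis x * cis y.
Proof.
rewrite /cis cosD sinD; apply/eqP; rewrite eq_complex /=.
by apply/andP; split; apply/eqP; ring.
Qed.

Lemma cisX x k : cis x ^+ k = cis (k%:R * x).
Proof.
elim: k => [|k IH]; first by rewrite mul0r /cis cos0 sin0.
by rewrite exprS IH -cisD -nat1r mulrDl mul1r.
Qed.

Lemma cabs_cis x : cabs (cis x) = 1.
Proof. by rewrite /cis /= cos2Dsin2 sqrtr1. Qed.

(** The standard primitive root of unity of order [4 * m]. With an order divisible by 4, quarter
    turns are integer powers, and the exponents from [m] to [3 * m] fill the closed left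
    half-plane. *)
Definition omega (m : nat) : R[i] := cis (pi / (2 * m%:R)).

Lemma cabs_omegaX m k : cabs (omega m ^+ k) = 1.
Proof. by rewrite cabsX cabs_cis expr1n. Qed.

Lemma omegaX_neq0 m k : omega m ^+ k != 0.
Proof. by rewrite -cabs_gt0 cabs_omegaX. Qed.

Lemma omegaX4m m : (0 < m)%N -> omega m ^+ (4 * m) = 1.
Proof.
move=> m0; have mR : m%:R != 0 :> R by rewrite pnatr_eq0 -lt0n.
rewrite cisX natrM.
have -> : 4 * m%:R * (pi / (2 * m%:R)) = pi *+ 2 :> R by field.
by rewrite /cis cos2pi sin2pi.
Qed.

Lemma Re_omegaX_le0 m k :
  (0 < m)%N -> (m <= k <= 3 * m)%N -> complex.Re (omega m ^+ k) <= 0.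
Proof.
move=> m0 /andP[mk k3]; have mR : 0 < m%:R :> R by rewrite ltr0n.
rewrite cisX /=.
set x := _ * _; rewrite -[x](subrK pi) cosDpi oppr_le0 cos_ge0_pihalf //.
have xE : x - pi = (k%:R - 2 * m%:R) / (2 * m%:R) * pi by rewrite /x; field; lra.
have pi0 := @pi_gt0 R.
rewrite xE; set e := (_ - _) / _.
have mk' : m%:R <= k%:R :> R by rewrite ler_nat.
have k3' : k%:R <= 3 * m%:R :> R by rewrite -natrM ler_nat.
have : - (1 / 2) <= e by rewrite /e ler_pdivlMr; lra.
have : e <= 1 / 2 by rewrite /e ler_pdivrMr; lra.
by move=> e1 e2; apply/andP; split; nra.
Qed.

Lemma multiple_window b n :
  (0 < b)%N -> exists k, (n <= b * k < n + b)%N.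
Proof.
move=> b0; exists ((n + b).-1 %/ b)%N.
have := divn_eq (n + b).-1 b; have := ltn_pmod (n + b).-1 b0; lia.
Qed.

(** If the power were 1, so would all its multiples be. For an exponent at most [m], some multiple
    falls in the left half-plane, where 1 does not lie; exponents above [3 * m] are reflected to
    [4 * m - b]. *)
Lemma omegaX_neq1 m b : (0 < b < 4 * m)%N -> omega m ^+ b != 1.
Proof.
move=> /andP[b0 bm]; have m0 : (0 < m)%N by lia.
have key c : (0 < c <= 3 * m)%N -> omega m ^+ c != 1.
  move=> /andP[c0 cm]; apply/eqP => wc.
  have [k /andP[k1 k2]] := multiple_window c m c0.
  have [c1|c1] := leqP c m.
    have : complex.Re (omega m ^+ (c * k)) <= 0 by apply: Re_omegaX_le0; lia.
    by rewrite exprM wc expr1n /= ler10.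
  have : complex.Re (omega m ^+ c) <= 0 by apply: Re_omegaX_le0; lia.
  by rewrite wc /= ler10.
have [b3|b3] := leqP b (3 * m); first by apply: key; rewrite b0.
apply/eqP => wb; have /eqP[] : omega m ^+ (4 * m - b) != 1 by apply: key; lia.
apply: (mulfI (omegaX_neq0 m b)).
by rewrite -exprD subnKC 1?ltnW // omegaX4m // wb mulr1.
Qed.

(** No estimate of the sine is used. Some multiple [b * k] lies between [m] and [2 * m], where the
    chord is at least 1; since that chord is at most [k] times the chord at [b], the latter is at
    least [1 / k], and [b * k <= 2 * m]. *)
Lemma inv_chord_small m b : (0 < b <= m)%N ->
  (cabs (1 - omega m ^+ b))^-1 <= (2 * m%:R) / b%:R.
Proof.
move=> /andP[b0 bm]; have m0 : (0 < m)%N by lia.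
have [k /andP[k1 k2]] := multiple_window b m b0.
have kk : 1 <= cabs (1 - (omega m ^+ b) ^+ k).
  by rewrite -exprM cabs_1B_ge1 // Re_omegaX_le0 //; lia.
have := le_trans kk (cabs_1BX_le _ k (cabs_omegaX m b)).
set c := cabs _; rewrite -mulr_natr => ck.
have k0 : 0 < k%:R :> R by rewrite ltr0n; lia.
have c0 : 0 < c by rewrite -(pmulr_lgt0 c k0); lra.
rewrite ler_pdivlMr ?ltr0n // -ler_pdivlMl ?invr_gt0 // invrK.
have : (b%:R * k%:R <= 2 * m%:R :> R) by rewrite -!natrM ler_nat; lia.
have : 0 < b%:R :> R by rewrite ltr0n.
nra.
Qed.

Lemma inv_chord_le m b : (0 < b < 4 * m)%N ->
  (cabs (1 - omega m ^+ b))^-1 <=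
    (2 * m%:R) / b%:R + (2 * m%:R) / (4 * m - b)%:R.
Proof.
move=> /andP[b0 bm]; have m0 : (0 < m)%N by lia.
have p1 : 0 <= (2 * m%:R) / b%:R :> R by rewrite divr_ge0 // mulr_ge0.
have p2 : 0 <= (2 * m%:R) / (4 * m - b)%:R :> R by rewrite divr_ge0 // mulr_ge0.
case: (leqP b m) => [b1|b1].
  by rewrite (le_trans (@inv_chord_small m b _)) ?lerDl // b0.
case: (leqP b (3 * m)) => [b3|b3]; last first.
  have -> : 1 - omega m ^+ b = - (omega m ^+ b * (1 - omega m ^+ (4 * m - b))).
    by rewrite mulrBr mulr1 -exprD subnKC 1?ltnW // omegaX4m // opprB.
  rewrite cabsN cabsM cabs_omegaX mul1r.
  by rewrite (le_trans (@inv_chord_small m _ _)) ?lerDr //; lia.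
have c1 : 1 <= cabs (1 - omega m ^+ b).
  by rewrite cabs_1B_ge1 // Re_omegaX_le0 // b3 ltnW.
apply: (@le_trans _ _ 1); first by rewrite invf_le1 // (lt_le_trans ltr01).
rewrite natrB 1?ltnW // natrM.
have bR : 0 < b%:R :> R by rewrite ltr0n.
have bm' : b%:R < 4 * m%:R :> R by rewrite -natrM ltr_nat.
(* In the middle range the chord is at least 1, while the right-hand side is at least 2 because
   [b * (4 * m - b) <= 4 * m ^ 2]. *)
have -> : 2 * m%:R / b%:R + 2 * m%:R / (4 * m%:R - b%:R) =
   8 * m%:R ^+ 2 / (b%:R * (4 * m%:R - b%:R)) :> R by field; lra.
rewrite ler_pdivlMr ?mulr_gt0; [|lra..].
have := sqr_ge0 (b%:R - 2 * m%:R : R); rewrite !expr2; nra.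
Qed.

(** Each dyadic block from [2 ^ r] to [2 ^ r.+1] has [2 ^ r] terms of size at most [1 / 2 ^ r], so
    it adds at most 1. *)
Lemma harmonic_pow2 r : \sum_(1 <= b < 2 ^ r) (b%:R^-1 : R) <= r%:R.
Proof.
elim: r => [|r IH]; first by rewrite big_geq.
have r0 : (0 < 2 ^ r)%N by rewrite expn_gt0.
rewrite (@big_cat_nat _ _ _ (2 ^ r)) ?expnS //=; last by lia.
rewrite -natr1 lerD // (@le_trans _ _ (\sum_(2 ^ r <= b < 2 * 2 ^ r) (2 ^ r)%:R^-1)) //.
  apply: ler_sum_nat => b /andP[b1 b2].
  by rewrite lef_pV2 ?ler_nat // posrE ltr0n //; lia.
rewrite sumr_const_nat mul2n -addnn addnK -(mulr_natr _^-1) mulVf //.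
Qed.

End RootsOfUnity.

(** * Weak-type estimate for the logarithmic derivative on the roots of unity *)

Lemma sumr_shift_periodic (V : zmodType) (c : nat -> V) M k :
  (forall i, c (i + M)%N = c i) ->
  \sum_(i < M) c (i + k)%N = \sum_(i < M) c i.
Proof.
move=> cM; elim: k => [|k IH]; first by apply: eq_bigr => i _; rewrite addn0.
rewrite -IH; case: M cM {IH} => [|M] cM; first by rewrite !big_ord0.
rewrite big_ord_recr big_ord_recl /= addrC; congr (_ + _).
  by rewrite add0n -(cM k) addnC addSnnS.
by apply: eq_bigr => i _; rewrite /bump /= add1n addSnnS.
Qed.

Section WeakType.
Context {R : realType} (m r : nat).
Hypothesis mr : (4 * m = 2 ^ r)%N.
Local Notation M := (4 * m)%N.
Local Notation w := (omega m : R[i]).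

Lemma m_gt0 : (0 < m)%N.
Proof. by have := expn_gt0 2 r; rewrite -mr /=; lia. Qed.

Lemma sum_inv_chord :
  \sum_(b < M) (cabs (1 - w ^+ b))^-1 <= M%:R * r%:R :> R.
Proof.
have m0 := m_gt0.
rewrite -(big_mkord xpredT (fun b => (cabs (1 - w ^+ b))^-1)).
rewrite big_ltn; last by lia.
(* The term [b = 0] is harmless: the inverse of 0 is 0 by convention. *)
rewrite expr0 subrr cabs0 invr0 add0r.
apply: (@le_trans _ _ (\sum_(1 <= b < M)
    ((2 * m%:R) / b%:R + (2 * m%:R) / (M - b)%:R))).
  by apply: ler_sum_nat => b hb; exact: inv_chord_le.
rewrite big_split /= [X in _ + X]big_nat_rev /=.
rewrite [X in _ + X](@eq_big_nat _ _ _ _ _ _ (fun b => 2 * m%:R / b%:R)).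
  rewrite -mulr_sumr -mulrDl.
  have -> : 2 * m%:R + 2 * m%:R = M%:R :> R by rewrite natrM; ring.
  by rewrite ler_wpM2l // {1}mr harmonic_pow2.
by move=> b hb; congr (_ / _%:R); lia.
Qed.

Lemma omega_periodic i : w ^+ (i + M) = w ^+ i.
Proof. by rewrite exprD omegaX4m ?mulr1 // m_gt0. Qed.

Lemma omega_inj (a b : 'I_M) : w ^+ a = w ^+ b -> a = b.
Proof.
wlog ab : a b / (a <= b)%N => [H|].
  by case/orP: (leq_total a b) => h e; [apply: H | apply/esym/H].
move=> e; apply/val_inj/eqP; rewrite eqn_leq ab /= leqNgt; apply/negP => lt.
have bM := ltn_ord b.
have /eqP[] : w ^+ (b - a) != 1 by apply: omegaX_neq1; lia.
by apply: (mulfI (omegaX_neq0 m a)); rewrite mulr1 -exprD subnKC.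
Qed.

(** Take for [a0] the index of the root of unity nearest to [z]. Any other root is then at least
    half as far from [z] as from that nearest root, which reduces the sum to [sum_inv_chord] and
    accounts for the factor 2. *)
Lemma sum_inv_dist (z : R[i]) : exists a0 : 'I_M,
  (forall a : 'I_M, a != a0 -> w ^+ a != z) /\
  \sum_(a < M | a != a0) (cabs (w ^+ a - z))^-1 <= 2 * (M%:R * r%:R).
Proof.
have m0 := m_gt0.
have M0 : (0 < M)%N by lia.
pose a0 : 'I_M := [arg min_(a < Ordinal M0) cabs (w ^+ a - z)]%O.
have a0P (a : 'I_M) : cabs (w ^+ a0 - z) <= cabs (w ^+ a - z).
  by rewrite /a0; case: arg_minP => // i _ H; exact: H.
have far (a : 'I_M) : a != a0 -> 0 < cabs (w ^+ a - w ^+ a0).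
  by move=> aa0; rewrite cabs_gt0 subr_eq0; apply: contra_neq aa0 => /omega_inj.
have near (a : 'I_M) : cabs (w ^+ a - w ^+ a0) <= 2 * cabs (w ^+ a - z).
  have -> : w ^+ a - w ^+ a0 = (w ^+ a - z) + (z - w ^+ a0) by rewrite addrA subrK.
  rewrite (le_trans (cabsD _ _)) // (cabs_distC z) mulr2n mulrDl mul1r lerD2l.
  exact: a0P.
have pos (a : 'I_M) : a != a0 -> 0 < cabs (w ^+ a - z).
  by move=> /far; have := near a; lra.
exists a0; split=> [a /pos|]; first by rewrite cabs_gt0 subr_eq0.
pose c i := (cabs (1 - w ^+ i))^-1 : R.
have c0 i : 0 <= c i by rewrite invr_ge0 cabs_ge0.
(* The index [a + (M - a0)] represents [a - a0] modulo [M] without truncated subtraction. *)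
apply: (@le_trans _ _ (\sum_(a < M | a != a0) 2 * c (a + (M - a0))%N)).
  apply: ler_sum => a aa0; have p1 := pos a aa0; have p2 := far a aa0.
  have -> : c (a + (M - a0))%N = (cabs (w ^+ a - w ^+ a0))^-1.
    rewrite /c; congr (_^-1).
    rewrite -[LHS]mul1r -(cabs_omegaX m a0) -cabsM mulrBr mulr1 -exprD addnCA.
    by rewrite subnKC 1?ltnW // omega_periodic cabs_distC.
  by rewrite ler_pdivlMr // mulrC ler_pdivrMr.
apply: (@le_trans _ _ (\sum_(a < M) 2 * c (a + (M - a0))%N)).
  by rewrite [leRHS](bigID (fun a => a != a0)) /= lerDl sumr_ge0 // => i _; rewrite mulr_ge0.
rewrite -mulr_sumr ler_wpM2l // (sumr_shift_periodic _ c) ?sum_inv_chord //.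
by move=> i; rewrite /c omega_periodic.
Qed.

(** The formula for [p' / p] as a sum over the zeros, multiplied out and with moduli taken; the
    induction is the product rule. *)
Lemma cabs_deriv_prod_le (rs : seq R[i]) x : x \notin rs ->
  let p := \prod_(z <- rs) ('X - z%:P) in
  cabs p^`().[x] <= cabs p.[x] * \sum_(z <- rs) (cabs (x - z))^-1.
Proof.
elim: rs => [|z rs IH] /=; first by rewrite !big_nil derivC horner0 cabs0 mulr0.
rewrite inE negb_or => /andP[xz /IH {}IH]; rewrite !big_cons.
set p := \prod_(_ <- _) _ in IH *; set S := \sum_(_ <- _) _ in IH *.
rewrite derivM derivXsubC mul1r hornerD !hornerM hornerXsubC.
rewrite (le_trans (cabsD _ _)) // !cabsM mulrDr mulrAC divff ?mul1r.
  by rewrite lerD2l -mulrA ler_wpM2l // cabs_ge0.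
by rewrite cabs_eq0 subr_eq0.
Qed.

(** [E] collects the index given by [sum_inv_dist] for each zero in turn. Enlarging [E] only drops
    nonnegative terms, so the bounds for the single zeros add up. *)
Lemma exceptional_set (rs : seq R[i]) : exists E : {set 'I_M},
  [/\ (#|E| <= size rs)%N,
     forall a : 'I_M, a \notin E -> w ^+ a \notin rs &
     \sum_(a < M | a \notin E) \sum_(z <- rs) (cabs (w ^+ a - z))^-1 <=
       (size rs)%:R * (2 * (M%:R * r%:R))].
Proof.
elim: rs => [|z rs [E [E1 E2 E3]]].
  exists finset.set0; split=> //; first by rewrite cards0.
  by rewrite mul0r big1 // => a _; rewrite big_nil.
have [a0 [za S0]] := sum_inv_dist z.
exists (a0 |: E)%SET; split=> /=.
- by rewrite cardsU1 (leq_add (leq_b1 _)).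
- move=> a; rewrite in_setU1 inE !negb_or => /andP[aa0 aE].
  by rewrite za //= E2.
under eq_bigr do rewrite big_cons.
rewrite big_split /= -nat1r mulrDl mul1r lerD //.
  apply: le_trans S0; rewrite [leRHS](bigID (fun a => a \in E)) /=.
  under eq_bigl do rewrite in_setU1 negb_or.
  by rewrite lerDr sumr_ge0 // => i _; rewrite invr_ge0 cabs_ge0.
apply: le_trans E3; rewrite [leRHS](bigID (fun a => a == a0)) /=.
under eq_bigl do rewrite in_setU1 negb_or andbC.
rewrite lerDr sumr_ge0 // => i _; rewrite sumr_ge0 // => j _.
by rewrite invr_ge0 cabs_ge0.
Qed.

(** Markov's inequality: a bad point outside the exceptional set contributes at least [y] to the sum
    bounded in [exceptional_set], and the exceptional set itself has at most deg [q] points. *)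
Lemma weak_type_log_deriv (q : {poly R[i]}) (y : R) : q != 0 -> 0 < y ->
  #|[set a : 'I_M | y * cabs q.[w ^+ a] < cabs q^`().[w ^+ a]]|%:R <=
    (size q).-1%:R * (1 + 2 * (M%:R * r%:R) / y).
Proof.
move=> q0 y0; have [rs qE] := closed_field_poly_normal q.
have lc0 : lead_coef q != 0 by rewrite lead_coef_eq0.
have sq : size rs = (size q).-1.
  by rewrite qE size_scale // size_prod_XsubC.
have [E [E1 E2 E3]] := exceptional_set rs.
set B := [set a : 'I_M | _].
rewrite -sq mulrDr mulr1 -(cardsID E B) natrD.
apply: lerD; first by rewrite ler_nat (leq_trans _ E1) // subset_leq_card ?subsetIr.
rewrite mulrA ler_pdivlMr //; apply: le_trans E3.
apply: (@le_trans _ _ (\sum_(a in (B :\: E)%SET) y)).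
  by rewrite sumr_const mulr_natl.
rewrite [leRHS](bigID (fun a => a \in B)) /=.
rewrite (eq_bigl (fun a => (a \notin E) && (a \in B))); last first.
  by move=> a; rewrite finset.in_setD.
rewrite ler_wpDr ?sumr_ge0 // => [i _|]; first by rewrite sumr_ge0 // => j _; rewrite invr_ge0 cabs_ge0.
apply: ler_sum => a /andP[aE]; rewrite inE.
have := cabs_deriv_prod_le rs (w ^+ a) (E2 a aE).
rewrite {1 2}qE derivZ !hornerZ !cabsM /=.
set p := \prod_(_ <- _) _; set S := \sum_(_ <- _) _ => le1 lt1.
have lc1 : 0 < cabs (lead_coef q) by rewrite cabs_gt0.
have lt2 : y * cabs p.[w ^+ a] < cabs p^`().[w ^+ a].
  by rewrite -(ltr_pM2l lc1) mulrCA.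
have p0 : 0 < cabs p.[w ^+ a].
  rewrite cabs_gt0 -/(root p _) /p root_prod_XsubC; exact: E2.
by rewrite ltW // -(ltr_pM2r p0) (lt_le_trans lt2) // mulrC.
Qed.

End WeakType.

(** * Small values of sparse polynomials on the roots of unity *)

Section Sparse.
Context {R : realType}.
Implicit Types q : {poly R[i]}.

Lemma norm0E q n : (size q <= n)%N -> norm0 q = (\sum_(i < n) (q`_i != 0)%R)%N.
Proof.
move=> qn; rewrite /norm0 -sum1_count (big_nth 0) big_mkord.
rewrite (big_ord_widen_cond n (fun i => q`_i != 0) (fun=> 1%N) qn).
rewrite [RHS](eq_bigr (fun i : 'I_n => if q`_i != 0 then 1%N else 0%N)); last first.
  by move=> i _; case: (_ != 0).
rewrite -big_mkcond /=; apply: eq_bigl => i.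
by case: (ltnP i (size q)) => [_|si]; rewrite ?andbT // nth_default // eqxx.
Qed.

Lemma norm0_mulX q : norm0 (q * 'X) = norm0 q.
Proof.
have [->|q0] := eqVneq q 0; first by rewrite mul0r.
by rewrite /norm0 polyseqMX //= eqxx.
Qed.

Lemma norm0_deriv q : q.[0] != 0 -> norm0 q = (norm0 q^`()).+1.
Proof.
rewrite horner_coef0 => q0.
have sq : (0 < size q)%N by rewrite lt0n size_poly_eq0; apply: contra_neq q0 => ->; rewrite coef0.
have [d sqE] : exists d, size q = d.+1 by exists (size q).-1; rewrite prednK.
rewrite (norm0E q d.+1) ?sqE // big_ord_recl q0 add1n; congr _.+1.
rewrite (norm0E q^`() d); last by rewrite -ltnS -sqE lt_size_deriv // -size_poly_gt0 sqE.
by apply: eq_bigr => i _; rewrite coef_deriv mulrn_eq0.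
Qed.

Lemma norm0_gt0 q : q != 0 -> (0 < norm0 q)%N.
Proof.
move=> q0; rewrite /norm0 -has_count; apply/hasP; exists (lead_coef q).
  by rewrite mem_nth // prednK // lt0n size_poly_eq0.
by rewrite lead_coef_eq0.
Qed.

Lemma norm0_le_size q : (norm0 q <= size q)%N.
Proof. exact: count_size. Qed.

Lemma size_deriv q : size q^`() = (size q).-1.
Proof.
have [q0|q0] := leqP (size q) 1.
  by rewrite (size1_polyC q0) derivC size_poly0 size_polyC; case: (_ != _).
rewrite /deriv; set F := fun i : nat => _; apply: (@size_poly_eq _ _ F).
rewrite /F prednK ?mulrn_eq0; last by lia.
by rewrite -lead_coefE lead_coef_eq0 negb_or -size_poly_gt0 -lt0n ltn_predRL q0 ltnW.
Qed.

Lemma lead_coef_deriv q : lead_coef q^`() = lead_coef q *+ (size q).-1.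
Proof.
rewrite !lead_coefE size_deriv coef_deriv.
have [s1|s1] := leqP (size q) 1; last by rewrite prednK //; lia.
have -> : (size q).-1 = 0%N by lia.
by rewrite mulr0n nth_default // mul0rn.
Qed.

(* Each step either divides by X, which does not change the modulus on the unit
   circle, or differentiates, which removes the constant term and multiplies
   the leading coefficient by the degree: exactly the factor lost in
   [weak_type_log_deriv]. *)
Lemma sparse_small_values (m r : nat) q (y : R) : (4 * m = 2 ^ r)%N ->
  q != 0 -> 0 < y ->
  #|[set a : 'I_(4 * m) | cabs q.[omega m ^+ a] * y ^+ (norm0 q).-1
                           < cabs (lead_coef q)]|%:R <=
  (norm0 q).-1%:R * ((size q).-1%:R + 2 * ((4 * m)%:R * r%:R) / y).
Proof.
move=> mr + y0; have [n] := ubnP (size q); elim: n q => // n IH q sqn q0.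
have K0 : 0 <= 2 * ((4 * m)%:R * r%:R) / y by rewrite divr_ge0 ?mulr_ge0 // ltW.
have [qz|qz] := eqVneq q.[0] 0.
  have [q1 qE] : exists q1, q = q1 * 'X.
    have /factor_theorem [q1] : root q 0 by apply/eqP.
    by rewrite subr0; exists q1.
  have q10 : q1 != 0 by apply: contra_neq q0 => q1z; rewrite qE q1z mul0r.
  have sq : size q = (size q1).+1 by rewrite qE size_mulX.
  have := IH q1 _ q10; rewrite -ltnS -sq => /(_ sqn) IH1.
  rewrite (eq_finset (fun a : 'I_(4 * m) => cabs q1.[omega m ^+ a] * y ^+ (norm0 q1).-1
                           < cabs (lead_coef q1))); last first.
    by move=> a; rewrite qE hornerMX cabsM cabs_omegaX mulr1 norm0_mulX lead_coefMX.
  have -> : norm0 q = norm0 q1 by rewrite qE norm0_mulX.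
  by rewrite (le_trans IH1) // ler_wpM2l // lerD2r ler_nat sq leq_pred.
(* For a constant the exponent of [y] is 0, and the strict inequality defining the set compares a
   number with itself. *)
have [s1|s1] := leqP (size q) 1.
  have [c qE] : exists c, q = c%:P by exists q`_0; exact: size1_polyC.
  have cq : (norm0 q <= 1)%N := leq_trans (norm0_le_size q) s1.
  have -> : (norm0 q).-1 = 0%N by lia.
  rewrite mul0r (eq_finset pred0) ?set0E ?cards0 // => a.
  by rewrite qE hornerC lead_coefC expr0 mulr1 ltxx.
pose d := (size q).-1; have d0 : 0 < d%:R :> R by rewrite ltr0n /d; lia.
have q'0 : q^`() != 0 by rewrite -size_poly_gt0 size_deriv; lia.
have sq' : (size q^`() < n)%N by rewrite size_deriv; lia.
have := IH _ sq' q'0; rewrite lead_coef_deriv size_deriv cabsMn -/d.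
have nq := norm0_deriv _ qz; rewrite nq /=.
have nq' := norm0_gt0 _ q'0; set s := norm0 q^`() in nq nq' *.
set A := [set a | _] => IHA; set B := [set a | _].
(* The threshold [d * y] cancels the degree [d] in front of the weak-type bound, so that each
   derivative costs [d] points plus the same term in [1 / y]. *)
have dy0 : 0 < d%:R * y by rewrite mulr_gt0.
have := weak_type_log_deriv m r mr q (d%:R * y) q0 dy0.
set W := [set a | _] => WW.
(* Outside [A] and [W], [d * |LC(q)| <= |q'| * y ^ s.-1 <= d * |q| * y ^ s], so the point is not in
   [B]. *)
have BAW : B \subset (A :|: W)%SET.
  apply/fintype.subsetP => a; rewrite finset.in_setU !inE => aB.
  have [//|Aa /=] := ltP.
  rewrite -(@ltr_pM2r _ (y ^+ s.-1)) ?exprn_gt0 //; apply: lt_le_trans Aa.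
  by rewrite -[X in _ < X]mulr_natl -!mulrA ltr_pM2l // mulrCA -exprS prednK // mulrC.
have BAWc : (#|B| <= #|A| + #|W|)%N.
  exact: leq_trans (subset_leq_card BAW) (leq_card_setU _ _).
have : #|B|%:R <= #|A|%:R + #|W|%:R :> R by rewrite -natrD ler_nat.
move=> /le_trans; apply.
rewrite -[X in _ <= X%:R * _](prednK nq') -natr1 mulrDl mul1r; apply: lerD.
  by rewrite (le_trans IHA) // ler_wpM2l // lerD2r ler_nat leq_pred.
apply: (le_trans WW); rewrite mulrDr mulr1 lerD2l -/d.
by rewrite le_eqVlt; apply/orP; left; apply/eqP; field; rewrite !gt_eqF.
Qed.

End Sparse.

(** * Parseval on the roots of unity and the L2 mass of the quotient *)

Lemma sqr_sum_le (R : realFieldType) (a : nat -> R) n :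
  (\sum_(i < n) a i) ^+ 2 <= n%:R * \sum_(i < n) a i ^+ 2.
Proof.
elim: n => [|n IH]; first by rewrite !big_ord0 mulr0 expr0n.
rewrite !big_ord_recr /=; set S := \sum_(i < n) _ in IH *.
set Q := \sum_(i < n) _ in IH *.
(* The empty sum is treated apart because the inductive step divides by the number of terms. *)
case: n => [|n] in S Q IH *; first by rewrite /S /Q !big_ord0 !add0r mul1r.
have n0 : 0 < n.+1%:R :> R by rewrite ltr0n.
rewrite -natr1; set k := n.+1%:R in IH n0 *; set x := a _.
have : 0 <= (S - k * x) ^+ 2 := sqr_ge0 _.
rewrite -(ler_pM2l n0) => H.
have : 0 <= k * (Q + k * x ^+ 2 - 2 * S * x) by nra.
rewrite pmulr_rge0 // => H2; nra.
Qed.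

Section Parseval.
Context {R : realType} (m r : nat).
Hypothesis mr : (4 * m = 2 ^ r)%N.
Local Notation M := (4 * m)%N.
Local Notation w := (omega m : R[i]).

Lemma omega_conj a : w ^+ a * (w ^+ a)^* = 1.
Proof. by rewrite -sqr_cabs cabs_omegaX expr1n. Qed.

(** Off the diagonal this is a geometric sum with ratio [v != 1] and [v ^+ M = 1]. *)
Lemma omega_orthogonal (i j : nat) : (i < M)%N -> (j < M)%N ->
  \sum_(a < M) (w ^+ a) ^+ i * ((w ^+ a) ^+ j)^* = (i == j)%:R * M%:R.
Proof.
move=> iM jM; pose v := w ^+ i * (w ^+ j)^*.
rewrite (eq_bigr (fun a : 'I_M => v ^+ a)); last first.
  by move=> a _; rewrite exprMn -rmorphXn -!exprM mulnC (mulnC a).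
have [ij|ij] := eqVneq i j.
  rewrite mul1r (eq_bigr (fun=> 1)) ?sumr_const ?card_ord //.
  by move=> a _; rewrite /v -ij omega_conj expr1n.
have v1 : v - 1 != 0.
  rewrite subr_eq0; apply: contra_neq ij => v1.
  have wij : w ^+ i = w ^+ j.
    by rewrite -[RHS]mul1r -v1 /v -mulrA (mulrC _ (w ^+ j)) omega_conj mulr1.
  exact: (congr1 val (omega_inj m r mr (Ordinal iM) (Ordinal jM) wij)).
apply: (mulfI v1); rewrite mul0r mulr0 -subrX1.
have wM k : (w ^+ k) ^+ M = 1 by rewrite exprAC omegaX4m ?expr1n // (m_gt0 m r mr).
by rewrite /v exprMn -rmorphXn !wM rmorph1 mulr1 subrr.
Qed.

Lemma norm2_sqr (p : {poly R[i]}) :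
  norm2 p ^+ 2 = \sum_(i < size p) cabs p`_i ^+ 2.
Proof. by rewrite sqr_sqrtr // sumr_ge0 // => i _; rewrite sqr_ge0. Qed.

(** The bound on [size h] prevents aliasing: distinct exponents below [M] give orthogonal
    characters. *)
Lemma parseval (h : {poly R[i]}) : (size h <= M)%N ->
  \sum_(a < M) cabs h.[w ^+ a] ^+ 2 = M%:R * norm2 h ^+ 2.
Proof.
move=> hM; rewrite norm2_sqr; apply: (@complexI R).
rewrite rmorphM !rmorph_sum rmorph_nat /=.
transitivity (\sum_(a < M) \sum_(i < size h) \sum_(j < size h)
   h`_i * (h`_j)^* * ((w ^+ a) ^+ i * ((w ^+ a) ^+ j)^*)).
  apply: eq_bigr => a _; rewrite sqr_cabs !horner_coef rmorph_sum big_distrlr /=.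
  apply: eq_bigr => i _; apply: eq_bigr => j _.
  by rewrite rmorphM /= mulrACA.
rewrite exchange_big mulr_sumr; apply: eq_bigr => i _ /=.
rewrite exchange_big (bigD1 i) //= [X in _ + X]big1 ?addr0.
  rewrite -mulr_sumr omega_orthogonal ?eqxx ?mul1r; last 2 first.
  - exact: leq_trans (ltn_ord i) hM.
  - exact: leq_trans (ltn_ord i) hM.
  by rewrite -sqr_cabs mulrC.
move=> j ij; rewrite -mulr_sumr omega_orthogonal.
- by rewrite eq_sym (negbTE (ij : (nat_of_ord j != i))) mul0r mulr0.
- exact: leq_trans (ltn_ord i) hM.
- exact: leq_trans (ltn_ord j) hM.
Qed.

Lemma cabs_horner_sqr_le (h : {poly R[i]}) z : cabs z = 1 ->
  cabs h.[z] ^+ 2 <= (size h)%:R * norm2 h ^+ 2.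
Proof.
move=> z1; rewrite norm2_sqr; apply: le_trans (sqr_sum_le _ (fun i => cabs h`_i) _).
by rewrite ler_sqr ?nnegrE ?cabs_ge0 ?cabs_horner_le // sumr_ge0 // => i _; rewrite cabs_ge0.
Qed.

Lemma norm1_ge0 (p : {poly R[i]}) : 0 <= norm1 p.
Proof. by rewrite sumr_ge0 // => i _; rewrite cabs_ge0. Qed.

(* The few points where [g] is small carry at most half of the L2 mass of [h]. *)
Lemma norm2_quotient_le (g h : {poly R[i]}) (y : R) :
  g != 0 -> 1 <= cabs (lead_coef g) -> 0 < y -> (size h <= M)%N ->
  (norm0 g).-1%:R * ((size g).-1%:R + 2 * (M%:R * r%:R) / y) * (size h)%:R
     <= M%:R / 2 ->
  norm2 h ^+ 2 <= 2 * (norm1 (g * h) * y ^+ (norm0 g).-1) ^+ 2.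
Proof.
move=> g0 lc y0 hM few; have M0 : 0 < M%:R :> R by rewrite ltr0n muln_gt0 (m_gt0 m r mr).
have := sparse_small_values m r g y mr g0 y0.
set B := [set a | _]; set T := norm1 _ * _ => cB.
have N0 : 0 <= (size h)%:R :> R by [].
have BM := le_trans (ler_wpM2r N0 cB) few.
have H0 : 0 <= norm2 h ^+ 2 by exact: sqr_ge0.
have := parseval _ hM; rewrite (bigID (mem B)) /=.
(* On the small set each value is bounded by Cauchy-Schwarz, and [few] makes the total at most half
   of the Parseval sum. *)
have S1 : \sum_(a in B) cabs h.[w ^+ a] ^+ 2 <= M%:R / 2 * norm2 h ^+ 2.
  apply: (@le_trans _ _ (\sum_(a in B) (size h)%:R * norm2 h ^+ 2)).
    by apply: ler_sum => a _; rewrite cabs_horner_sqr_le // cabs_omegaX.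
  by rewrite sumr_const -(mulr_natl (_ * _)) mulrA ler_wpM2r.
have S2 : \sum_(a < M | a \notin B) cabs h.[w ^+ a] ^+ 2 <= M%:R * T ^+ 2.
  apply: (@le_trans _ _ (\sum_(a < M) T ^+ 2)); last first.
    by rewrite sumr_const card_ord mulr_natl.
  rewrite [leRHS](bigID (fun a => a \notin B)) /= ler_wpDr ?sumr_ge0 //.
    by move=> a _; rewrite sqr_ge0.
  apply: ler_sum => a; rewrite inE -leNgt => ga.
  have T0 : 0 <= T by rewrite mulr_ge0 ?norm1_ge0 ?exprn_ge0 // ltW.
  rewrite ler_sqr ?nnegrE ?cabs_ge0 //.
  have fa : cabs g.[w ^+ a] * cabs h.[w ^+ a] <= norm1 (g * h).
    by rewrite -cabsM -hornerM cabs_horner_le // cabs_omegaX.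
  have yk : 0 < y ^+ (norm0 g).-1 by rewrite exprn_gt0.
  apply: le_trans (ler_wpM2r (ltW yk) fa).
  by rewrite mulrAC ler_peMl ?cabs_ge0 // (le_trans lc).
move=> E; have : M%:R * norm2 h ^+ 2 <= M%:R * (2 * T ^+ 2).
  move: E S1 S2; set s1 := \sum_(_ in _) _; set s2 := \sum_(_ < _ | _) _; lra.
by rewrite ler_pM2l.
Qed.

End Parseval.

(** * Choice of the parameters and the resulting bound for the quotient *)

Lemma exceptional_budget (R : realFieldType) (s n D r P N : R) :
  1 <= s -> 0 < n -> 0 < D -> 0 < r -> 0 <= N <= D ->
  4 * s * n * D <= P ->
  (s - 1) * (n + 2 * (P * r) / (8 * (s * D * r))) * N <= P / 2.
Proof.
move=> s1 n0 D0 r0 /andP[N0 ND] LP; have s0 : 0 < s by lra.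
have P0 : 0 <= P by apply: le_trans LP; rewrite !mulr_ge0 // ltW.
have p1 : 0 <= n + 2 * (P * r) / (8 * (s * D * r)).
  by rewrite addr_ge0 ?divr_ge0 ?mulr_ge0 // ltW.
apply: (@le_trans _ _ (s * (n + 2 * (P * r) / (8 * (s * D * r))) * D)).
  apply: ler_pM => //; first by rewrite mulr_ge0 // subr_ge0.
  by rewrite ler_wpM2r // lerBlDr lerDl.
(* The constant 8 makes the second contribution exactly [P / 4]; the constant 4 in
   [4 * s * n * D <= P] makes the first one at most [P / 4]. *)
have -> : s * (n + 2 * (P * r) / (8 * (s * D * r))) * D = s * n * D + P / 4.
  by field; rewrite !gt_eqF.
lra.
Qed.

Section QuotientBound.
Context {R : realType}.
Implicit Types g h : {poly R[i]}.

Lemma norm0_ge2 g : g.[0] != 0 -> (0 < deg g)%N -> (1 < norm0 g)%N.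
Proof.
move=> g0 dg; rewrite norm0_deriv // ltnS norm0_gt0 //.
by rewrite -size_poly_gt0 size_deriv.
Qed.

Lemma size_quotient_le g h : g != 0 -> h != 0 -> (0 < deg g)%N ->
  (0 < size h <= deg (g * h))%N.
Proof.
move=> g0 h0; rewrite /deg size_mul // size_poly_gt0 h0.
by set a := size h; set b := size g; lia.
Qed.

Lemma deg_factor_le g h : g != 0 -> h != 0 -> (deg g <= deg (g * h))%N.
Proof.
move=> g0 h0; have := size_poly_gt0 h; rewrite h0 /deg size_mul //.
by set a := size h; set b := size g; lia.
Qed.

(** The sample size is the least power of two that is at least [4 * s * n * D], and
    [y = 8 * s * D * r]. The factor [Num.sqrt 2] pays for the half of the L2 mass lost on the small
    set. *)
Lemma norm2_quotient_log_le g h : (g * h).[0] != 0 -> (0 < deg g)%N ->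
  1 <= cabs (lead_coef g) ->
  norm2 h <= norm1 (g * h) * (Num.sqrt 2 *
    (8 * (norm0 g * deg (g * h) *
       up_log 2 (4 * norm0 g * deg g * deg (g * h)))%:R) ^+ (norm0 g).-1).
Proof.
move=> fz dg lc; have := fz; rewrite hornerM mulf_eq0 negb_or => /andP[gz hz].
have g0 : g != 0 by apply: contra_neq gz => ->; rewrite horner0.
have h0 : h != 0 by apply: contra_neq hz => ->; rewrite horner0.
have s2 := norm0_ge2 g gz dg.
have /andP[sh0 sh] := size_quotient_le g h g0 h0 dg.
have D0 := leq_trans sh0 sh; have s0 := ltnW s2.
set s := norm0 g in s2 s0 *; set D := deg (g * h) in sh D0 *.
set n := deg g in dg *; set L := (4 * s * n * D)%N.
have L8 : (8 <= L)%N.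
  have : (2 * 1 * 1 <= s * n * D)%N by rewrite !leq_mul.
  by rewrite /L; lia.
have [r -> rL] : exists2 r, up_log 2 L = r & (L <= 2 ^ r)%N.
  by exists (up_log 2 L) => //; exact: up_logP.
(* At least two factors 2 are required for the sample size [2 ^ r] to have the form [4 * m]. *)
have r2 : (1 < r)%N.
  by rewrite -(ltn_exp2l 1 r (isT : (1 < 2)%N)) (leq_trans _ rL) // (leq_trans _ L8).
have mr : (4 * 2 ^ (r - 2) = 2 ^ r)%N by rewrite -(expnD 2 2) subnKC.
have hM : (size h <= 4 * 2 ^ (r - 2))%N.
  rewrite mr; apply: leq_trans sh (leq_trans _ rL).
  by rewrite /L leq_pmull // !muln_gt0 s0 dg.
have y0 : 0 < 8 * (s * D * r)%:R :> R.
  by rewrite mulr_gt0 // ltr0n !muln_gt0 s0 D0 ltnW.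
have := norm2_quotient_le _ _ mr g h _ g0 lc y0 hM; rewrite mr => H.
have T0 : 0 <= norm1 (g * h) * (8 * (s * D * r)%:R) ^+ s.-1.
  by rewrite mulr_ge0 ?norm1_ge0 ?exprn_ge0 // ltW.
rewrite mulrCA -ler_sqr ?nnegrE ?sqrtr_ge0 ?(mulr_ge0 (sqrtr_ge0 _) T0) //.
rewrite (exprMn _ (Num.sqrt 2)) (sqr_sqrtr (ler0n R 2)); apply: H.
rewrite !natrM -subn1 natrB //; apply: exceptional_budget.
- by rewrite ler1n.
- by rewrite ltr0n.
- by rewrite ltr0n.
- by rewrite ltr0n ltnW.
- by rewrite ler0n ler_nat.
- by rewrite -!natrM ler_nat.
Qed.

End QuotientBound.

(** * Comparison of norms, and leading coefficients of integer polynomials *)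

Lemma sqrt2_le2 (R : realType) : Num.sqrt 2 <= 2 :> R.
Proof. by rewrite -ler_sqr ?nnegrE ?sqrtr_ge0 // sqr_sqrtr //; lra. Qed.

Section Norms.
Context {R : realType}.
Implicit Types p : {poly R[i]}.

Lemma cabs_coef_le_norm_inf p i : cabs p`_i <= norm_inf p.
Proof.
have [ip|ip] := ltnP i (size p).
  exact: (le_bigmax _ (fun i : 'I_(size p) => cabs p`_i) (Ordinal ip)).
by rewrite nth_default // cabs0; exact: bigmax_ge_id.
Qed.

Lemma norm_inf_gt0 p : p != 0 -> 0 < norm_inf p.
Proof.
move=> p0; apply: lt_le_trans (cabs_coef_le_norm_inf p (size p).-1).
by rewrite cabs_gt0 -lead_coefE lead_coef_eq0.
Qed.

Lemma norm_inf_le_norm2 p : norm_inf p <= norm2 p.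
Proof.
apply: bigmax_le => [|i _]; first exact: sqrtr_ge0.
rewrite -(@ler_sqr _ (cabs _)) ?nnegrE ?sqrtr_ge0 ?cabs_ge0 //.
rewrite norm2_sqr (bigD1 i) //= lerDl sumr_ge0 // => j _.
exact: sqr_ge0.
Qed.

Lemma norm1_le_norm_inf p : norm1 p <= (size p)%:R * norm_inf p.
Proof.
apply: (@le_trans _ _ (\sum_(i < size p) norm_inf p)).
  by apply: ler_sum => i _; exact: cabs_coef_le_norm_inf.
by rewrite sumr_const card_ord mulr_natl.
Qed.

Lemma cabs_intr_ge1 (k : int) : k != 0 -> 1 <= cabs (k%:~R : R[i]).
Proof.
have H n : (0 < n)%N -> 1 <= cabs (n%:R : R[i]).
  by move=> n0; rewrite cabsMn cabs1 ler1n.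
case: k => [[|n]|n] // _; first exact: H.
by rewrite NegzE mulrNz cabsN; exact: H.
Qed.

Lemma int_poly_lead_coef_ge1 p :
  p != 0 -> int_poly p -> 1 <= cabs (lead_coef p).
Proof.
move=> p0 [q pE]; move: p0; rewrite pE => qE0.
have q0 : q != 0 by apply: contra_neq qE0 => ->; rewrite rmorph0.
rewrite lead_coef_map_eq ?cabs_intr_ge1 ?lead_coef_eq0 //.
by rewrite intr_eq0 lead_coef_eq0.
Qed.

End Norms.

(** * Binary logarithms, real and rounded up *)

Section Log2.
Context {R : realType}.
Implicit Types x y : R.

Lemma ln2_gt0 : 0 < ln 2 :> R.
Proof. by rewrite ln_gt0 // ltr1n. Qed.

Lemma ler_log2 x y : 0 < x -> x <= y -> log2 x <= log2 y.
Proof.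
move=> x0 xy; rewrite ler_pM2r ?invr_gt0 ?ln2_gt0 // ler_ln ?posrE //.
exact: lt_le_trans xy.
Qed.

Lemma log2M x y : 0 < x -> 0 < y -> log2 (x * y) = log2 x + log2 y.
Proof. by move=> x0 y0; rewrite /log2 lnM ?posrE // mulrDl. Qed.

Lemma log2X x n : 0 < x -> log2 (x ^+ n) = n%:R * log2 x.
Proof. by move=> x0; rewrite /log2 lnXn // -[_ *+ n]mulr_natl mulrA. Qed.

Lemma log2_2 : log2 2 = 1 :> R.
Proof. by rewrite /log2 divff // gt_eqF ?ln2_gt0. Qed.

Lemma up_log2_le_log2 n x : (1 < n)%N -> 0 < x -> n%:R <= x ->
  (up_log 2 n)%:R <= log2 x + 1.
Proof.
move=> n1 x0 nx; have := up_log_gtn (isT : (1 < 2)%N) n1.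
have := up_log_gt0 2 n; rewrite n1 /=; set r := up_log 2 n => r0 lt_rn.
have log_pow : log2 (2 ^+ r.-1) = r.-1%:R :> R by rewrite log2X // log2_2 mulr1.
rewrite -{1}(prednK r0) -natr1 lerD2r -log_pow.
rewrite ler_log2 ?exprn_gt0 // (le_trans _ nx) // -natrX ler_nat.
exact: ltnW.
Qed.

End Log2.

(** * Comparison of the explicit bound with the soft-O expression *)

Section BaseArg.
Context {R : realType} (s n D : nat).
Hypotheses (s2 : (1 < s)%N) (n1 : (0 < n)%N) (nD : (n <= D)%N).

(* AM-GM on the two summands of [base_arg]. *)
Lemma base_arg_ge : 2 * Num.sqrt n%:R * (s%:R * D%:R) <= base_arg R s n D.
Proof.
have n0 : 0 < n%:R :> R by rewrite ltr0n.
have a0 : 0 < Num.sqrt n%:R :> R by rewrite sqrtr_gt0.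
have s0 : 1 <= s%:R :> R by rewrite ler1n ltnW.
rewrite /base_arg ler_pdivlMr //.
have -> : 2 * Num.sqrt n%:R * (s%:R * D%:R) * Num.sqrt n%:R =
    2 * (s%:R * n%:R) * D%:R :> R.
  by rewrite -[X in _ = 2 * (_ * X) * _](sqr_sqrtr (ltW n0)); ring.
(* The powers [5 / 2] and [1 / 2] of [s] are rounded down to 2 and 0; what remains is a sum of two
   squares. *)
have p : s%:R ^+ 2 <= s%:R `^ (5 / 2) :> R.
  by rewrite -powR_mulrn ?ler_powR //; lra.
have q : 1 <= Num.sqrt s%:R :> R by rewrite -[leLHS]sqrtr1 ler_wsqrtr.
apply: (@le_trans _ _ (s%:R ^+ 2 * n%:R ^+ 2 + 1 * D%:R ^+ 2)).
  by have := sqr_ge0 (s%:R * n%:R - D%:R : R); lra.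
by apply: lerD; rewrite ler_wpM2r ?sqr_ge0.
Qed.

Local Notation t := (base_arg R s n D).
Local Notation r := (up_log 2 (4 * s * n * D)).

(** By [base_arg_ge], [4 * s * n * D] is at most the square of [t], so [r <= 2 * log2 t + 1]; the
    final 1 is absorbed since [t >= 2]. *)
Lemma up_log_le_base_arg : r%:R <= 3 * log2 t /\ 4 <= t.
Proof.
have a1 : 1 <= Num.sqrt n%:R :> R by rewrite -[leLHS]sqrtr1 ler_wsqrtr // ler1n.
have sR : 2 <= s%:R :> R by rewrite ler_nat.
have nR : 1 <= n%:R :> R by rewrite ler1n.
have DR : 1 <= D%:R :> R by rewrite ler1n; lia.
have tg := base_arg_ge.
have sD : 2 <= s%:R * D%:R :> R by nra.
have t4 : 4 <= t by apply: le_trans tg; nra.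
split=> //.
have L1 : (1 < 4 * s * n * D)%N.
  have : (2 * 1 * 1 <= s * n * D)%N by rewrite !leq_mul //; lia.
  by lia.
have t0 : 0 < t by lra.
have := up_log2_le_log2 _ (t ^+ 2) L1 (exprn_gt0 2 t0).
rewrite log2X // => H.
have l1 : 1 <= log2 t by rewrite -[leLHS]log2_2 ler_log2 //; lra.
apply: le_trans (H _) _; last lra.
rewrite !natrM; have sq := sqr_sqrtr (ler0n R n).
apply: (@le_trans _ _ ((2 * Num.sqrt n%:R * (s%:R * D%:R)) ^+ 2)); last first.
  by rewrite ler_sqr ?nnegrE //; lra.
have -> : (2 * Num.sqrt n%:R * (s%:R * D%:R)) ^+ 2 =
  4 * n%:R * (s%:R * D%:R) * (s%:R * D%:R) :> R by rewrite -[in RHS]sq; ring.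
have -> : 4 * s%:R * n%:R * D%:R = 4 * n%:R * (s%:R * D%:R) * 1 :> R by ring.
by rewrite ler_wpM2l ?mulr_ge0 //; lra.
Qed.

(** The constant is [24 = 8 * 3], with 3 from [up_log_le_base_arg]. The spare factor
    [2 * Num.sqrt n%:R] is kept for [soft_O_exp_ge]. *)
Lemma soft_O_ge :
  2 * Num.sqrt n%:R * (8 * (s * D * r)%:R) <= soft_O 24 1 t.
Proof.
have [rl t4] := up_log_le_base_arg; rewrite /soft_O expr1 !natrM.
have tg := base_arg_ge.
have -> : 2 * Num.sqrt n%:R * (8 * (s%:R * D%:R * r%:R)) =
   8 * (2 * Num.sqrt n%:R * (s%:R * D%:R)) * r%:R :> R by ring.
apply: (@le_trans _ _ (8 * t * (3 * log2 t))); last by lra.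
by apply: ler_pM => //; rewrite ?mulr_ge0 ?ler_wpM2l // sqrtr_ge0.
Qed.

Lemma soft_O_exp_ge :
  Num.sqrt 2 * (8 * (s * D * r)%:R) ^+ s.-1 <=
  Num.sqrt (s%:R / n%:R) * soft_O 24 1 t ^+ (s - 1) :> R.
Proof.
have := soft_O_ge; set A := 8 * _; set T := soft_O _ _ _ => TA.
have n0 : 0 < n%:R :> R by rewrite ltr0n.
have a0 : 0 < Num.sqrt n%:R :> R by rewrite sqrtr_gt0.
have A0 : 0 <= A by rewrite mulr_ge0.
have a1 : 1 <= Num.sqrt n%:R :> R by rewrite -[leLHS]sqrtr1 ler_wsqrtr // ler1n.
have s1 : 1 <= Num.sqrt s%:R :> R by rewrite -[leLHS]sqrtr1 ler_wsqrtr // ler1n ltnW.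
rewrite sqrtrM // sqrtrV // subn1; set p := s.-1.
have p0 : (0 < p)%N by rewrite /p; lia.
have w2 := @sqrt2_le2 R.
apply: (@le_trans _ _ (2 * A ^+ p)); first by rewrite ler_wpM2r // exprn_ge0.
apply: (@le_trans _ _ ((Num.sqrt n%:R)^-1 * T ^+ p)); last first.
  rewrite ler_wpM2r ?exprn_ge0 //; last by rewrite ler_peMl // invr_ge0 ltW.
  by apply: le_trans TA; rewrite !mulr_ge0 // ltW.
rewrite ler_pdivlMl //.
(* As [p >= 1], one of the spare factors [2 * Num.sqrt n%:R] absorbs both [Num.sqrt 2], bounded by
   2, and the division by [Num.sqrt n%:R]. *)
apply: (@le_trans _ _ ((2 * Num.sqrt n%:R * A) ^+ p)); last first.
  by rewrite lerXn2r // nnegrE ?(le_trans _ TA) // !mulr_ge0 // ltW.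
rewrite (exprMn p (2 * _) A) mulrA (mulrC _ 2) ler_wpM2r ?exprn_ge0 //.
by rewrite ler_eXnr //; lra.
Qed.

End BaseArg.

(** * The logarithmic bound on the size of the quotient *)

Section CoarseBound.
Context {R : realType}.
Implicit Types g h : {poly R[i]}.

Lemma norm2_const h : (size h <= 1)%N -> norm2 h = cabs h`_0.
Proof.
move=> h1; have [->|h0] := eqVneq h 0.
  by rewrite /norm2 size_poly0 big_ord0 sqrtr0 coef0 cabs0.
have -> : norm2 h = Num.sqrt (\sum_(i < 1) cabs h`_i ^+ 2).
  by rewrite /norm2; have -> : size h = 1%N by apply/eqP; rewrite eqn_leq h1 size_poly_gt0.
by rewrite big_ord1 sqrtr_sqr ger0_norm // cabs_ge0.
Qed.

(** Bounding the logarithm by its argument and [s] by [2 * D] gives [2 ^ 7 * D ^ 5]; then [2 <= D]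
    turns the constant into seven more powers of [D]. *)
Lemma coarse_base_le (s n D : nat) : (1 < D)%N -> (0 < n <= D)%N -> (s <= n.+1)%N ->
  (8 * (s * D * up_log 2 (4 * s * n * D)) <= D ^ 12)%N.
Proof.
move=> D2 /andP[n0 nD] sn.
have rL : (up_log 2 (4 * s * n * D) <= 4 * s * n * D)%N.
  by apply: up_log_min => //; apply: ltnW; apply: ltn_expl.
set r := up_log _ _ in rL *.
have s2 : (s <= 2 * D)%N by lia.
apply: (@leq_trans (8 * (2 * D * D * (4 * (2 * D) * D * D)))).
  by rewrite leq_mul // leq_mul ?leq_mul // (leq_trans rL) // !leq_mul.
have -> : (8 * (2 * D * D * (4 * (2 * D) * D * D)) = 2 ^ 7 * D ^ 5)%N.
  by rewrite !expnS expn0; ring.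
by rewrite -[12%N]/(7 + 5)%N expnD leq_mul // leq_exp2r.
Qed.

Lemma log2_norm2_quotient_le g h : (g * h).[0] != 0 -> (0 < deg g)%N ->
  1 <= cabs (lead_coef g) ->
  log2 (norm2 h) <=
    log2 (norm_inf (g * h)) + 12 * ((norm0 g)%:R * log2 (deg (g * h))%:R).
Proof.
move=> fz dg lc; have := fz; rewrite hornerM mulf_eq0 negb_or => /andP[gz hz].
have g0 : g != 0 by apply: contra_neq gz => ->; rewrite horner0.
have h0 : h != 0 by apply: contra_neq hz => ->; rewrite horner0.
have f0 : g * h != 0 by rewrite mulf_neq0.
have nf := norm_inf_gt0 _ f0.
have nh : 0 < norm2 h by apply: lt_le_trans (norm_inf_gt0 _ h0) (norm_inf_le_norm2 h).
have /andP[sh0 sh] := size_quotient_le g h g0 h0 dg.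
have dgf := deg_factor_le g h g0 h0.
(* For degree 1 the error term vanishes since [log2 1 = 0], so the inequality must hold without
   loss: [h] is then a constant, at most the leading coefficient of [g * h] in modulus. *)
have [D1|D1] := leqP (deg (g * h)) 1.
  have -> : deg (g * h) = 1%N by lia.
  rewrite [X in 12 * (_ * X)]/log2 ln1 mul0r !mulr0 addr0 ler_log2 //.
  have h1 := leq_trans sh D1.
  rewrite norm2_const // (le_trans _ (cabs_coef_le_norm_inf _ (size (g * h)).-1)) //.
  rewrite -lead_coefE lead_coefM cabsM (@lead_coefE _ h).
  have -> : size h = 1%N by apply/eqP; rewrite eqn_leq h1 sh0.
  by rewrite ler_peMl ?cabs_ge0.
have := norm2_quotient_log_le g h fz dg lc.
have sg : (norm0 g <= (deg g).+1)%N.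
  by rewrite /deg prednK ?norm0_le_size // size_poly_gt0.
have := coarse_base_le (norm0 g) (deg g) (deg (g * h)) D1 _ sg.
rewrite dg dgf => /(_ isT).
set A := (8 * _)%N => AD; rewrite -(natrM _ 8) -/A => hA.
have s0 := norm0_gt0 _ g0.
have n1 := norm1_le_norm_inf (g * h).
have sf : size (g * h) = (deg (g * h)).+1 by rewrite /deg prednK // size_poly_gt0.
move: AD hA n1 sf D1; set D := deg (g * h) => AD hA n1 sf D1.
clearbody A; have [p sE] : exists p, norm0 g = p.+1.
  by exists (norm0 g).-1; rewrite prednK.
rewrite sE /= in hA *.
have DR : 2 <= D%:R :> R by rewrite ler_nat.
have D0 : 0 < D%:R :> R by lra.
rewrite mulrA -(natrM _ 12) -log2X // -log2M ?exprn_gt0 // ler_log2 //.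
apply: (le_trans hA).
have w2 := @sqrt2_le2 R.
apply: (@le_trans _ _ ((D%:R + 1) * norm_inf (g * h) * (2 * (D%:R ^+ 12) ^+ p))).
  apply: ler_pM; rewrite ?norm1_ge0 ?mulr_ge0 ?sqrtr_ge0 ?exprn_ge0 //.
    by rewrite natr1 -sf.
  apply: ler_pM; rewrite ?sqrtr_ge0 ?exprn_ge0 //.
  by rewrite lerXn2r ?nnegrE ?exprn_ge0 // -natrX ler_nat.
have -> : (D%:R + 1) * norm_inf (g * h) * (2 * (D%:R ^+ 12) ^+ p) =
  norm_inf (g * h) * ((2 * (D%:R + 1)) * D%:R ^+ (12 * p)) :> R.
  by rewrite exprM; ring.
rewrite ler_wpM2l ?(ltW nf) //.
rewrite mulnS (exprD _ 12) ler_wpM2r ?exprn_ge0 //.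
(* The exponent [norm0 g - 1] leaves one factor [D ^ 12] to spare, which covers the 2 and the number
   [D + 1] of coefficients, as [2 * (D + 1) <= D ^ 3] for [D >= 2]. *)
apply: (@le_trans _ _ (D%:R ^+ 3)); last by rewrite ler_eXn2l //; lra.
by rewrite !exprS expr0; nra.
Qed.

End CoarseBound.

Theorem corollary1p10 (R : realType) :
  exists (C : R) (k : nat) (C' : R), 0 < C /\ 0 < C' /\
  forall f g h : {poly R[i]},
    f = g * h ->
    f.[0] != 0 ->
    (0 < deg g)%N ->
    (int_poly f /\ int_poly g /\ int_poly h) \/
      (1 <= cabs (lead_coef g) /\ 1 <= cabs (trail_coef g)) ->
    norm2 h <=
      Num.sqrt ((norm0 g)%:R / (deg g)%:R) * norm1 f *
      soft_O C k (base_arg R (norm0 g) (deg g) (deg f)) ^+ (norm0 g - 1)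
    /\ log2 (norm_inf h) <= log2 (norm2 h)
    /\ log2 (norm2 h) <=
         log2 (norm_inf f) + C' * ((norm0 g)%:R * log2 (deg f)%:R).
Proof.
(* 24 and the single logarithm come from [soft_O_ge], 12 from the exponent in [coarse_base_le]. *)
exists 24, 1%N, 12; do 2!split=> //.
move=> f g h -> fz dg hyp.
have := fz; rewrite hornerM mulf_eq0 negb_or => /andP[gz hz].
have g0 : g != 0 by apply: contra_neq gz => ->; rewrite horner0.
have h0 : h != 0 by apply: contra_neq hz => ->; rewrite horner0.
(* In the integer case the leading coefficient is a nonzero integer, so both alternatives supply
   this bound. *)
have lc : 1 <= cabs (lead_coef g).
  by case: hyp => [[_ [gi _]]|[]] //; exact: int_poly_lead_coef_ge1.
have dgf := deg_factor_le g h g0 h0.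
split; last split.
- apply: le_trans (norm2_quotient_log_le g h fz dg lc) _.
  rewrite mulrAC -[leRHS]mulrC ler_wpM2l ?norm1_ge0 //.
  exact: soft_O_exp_ge (norm0_ge2 g gz dg) dg dgf.
- exact: ler_log2 (norm_inf_gt0 _ h0) (norm_inf_le_norm2 h).
- exact: log2_norm2_quotient_le.
Qed.
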